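(* Let $d\in\mathbb{N}_+$. For any finite set $A\subseteq[0,1]^d\cap\bigcup_{n\in\mathbb{N}_+}\frac1{2^n}\mathbb{Z}^d$, any concave modulus of continuity $\omega$, and any $\omega$-uniformly continuous function $f:A\to\mathbb{R}$, there is an $\omega$-uniformly continuous ReLU MLP $\Phi:\mathbb{R}^d\to\mathbb{R}$ extending $f$, i.e. $$f(\mathbf{x})=\Phi(\mathbf{x})\quad\text{for all }\mathbf{x}\in A.$$
   Context: A modulus of continuity is a monotone increasing (not necessarily strictly) function $\omega:[0,\infty)\to[0,\infty)$ with $\omega(0)=0$ that is continuous from the right at $0$. A function $g:X\to\mathbb{R}$ on $X\subseteq\mathbb{R}^d$ is $\omega$-uniformly continuous if $|g(\mathbf{x})-g(\mathbf{y})|\le\omega(\|\mathbf{x}-\mathbf{y}\|_1)$ for all $\mathbf{x},\mathbf{y}\in X$ ($\ell^1$ norm). (For example $\omega(t)=Lt^\alpha$ with $L\ge0$, $\alpha\in(0,1]$ gives $\alpha$-Hölder functions with coefficient $L$.) ReLU MLP: a function $\Phi:\mathbb{R}^{d_1}\to\mathbb{R}^{d_{\Delta+1}}$ with a representation $\mathbf{x}^{(1)}=\mathbf{x}$, $\mathbf{x}^{(l+1)}=\operatorname{ReLU}(\mathbf{W}^{(l)}\mathbf{x}^{(l)}+\mathbf{b}^{(l)})$ for $l=1,\dots,\Delta-1$ (ReLU$(t)=\max\{0,t\}$ applied componentwise), $\Phi(\mathbf{x})=\mathbf{W}^{(\Delta)}\mathbf{x}^{(\Delta)}+\mathbf{b}^{(\Delta)}$,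 where $\mathbf{W}^{(l)}\in\mathbb{R}^{d_{l+1}\times d_l}$, $\mathbf{b}^{(l)}\in\mathbb{R}^{d_{l+1}}$, and $\Delta,d_2,\dots,d_\Delta\in\mathbb{N}_+$ are arbitrary. *)

(* Defs.v *)
From mathcomp Require Export all_boot all_order all_algebra.
From mathcomp Require Export all_classical reals topology normedtype convex.

Set Implicit Arguments.
Unset Strict Implicit.
Unset Printing Implicit Defensive.

Import Order.TTheory GRing.Theory Num.Theory.
Import numFieldNormedType.Exports.

Local Open Scope classical_set_scope.
Local Open Scope ring_scope.

(* Moduli of continuity are functions on [0, +oo[; they are represented by
   functions R -> R whose values at negative arguments are irrelevant. *)
Definition modulus_of_continuity (R : realType) (w : R -> R) : Prop :=
  [/\ forall t, 0 <= t -> 0 <= w t,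
      forall s t, 0 <= s -> s <= t -> w s <= w t,
      w 0 = 0
    & w t @[t --> 0^'+] --> w 0].

Definition concave_modulus (R : realType) (w : R -> R) : Prop :=
  modulus_of_continuity w /\
  convex_function (`[0, +oo[ : set R) (fun t => - w t).

Definition l1norm (R : realType) (d : nat) (x : 'cV[R]_d) : R :=
  \sum_(i < d) `|x i 0|.

Definition uniformly_continuous_by (R : realType) (d : nat) (w : R -> R)
    (X : set 'cV[R]_d) (g : 'cV[R]_d -> R) : Prop :=
  forall x y, X x -> X y -> `|g x - g y| <= w (l1norm (x - y)).

Definition unit_cube (R : realType) (d : nat) : set 'cV[R]_d :=
  [set x | forall i, 0 <= x i 0 <= 1].

Definition dyadic_grid (R : realType) (d n : nat) : set 'cV[R]_d :=
  [set x | forall i, exists z : int, x i 0 = z%:~R / 2 ^+ n].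

Definition relu (R : realType) (d : nat) (x : 'cV[R]_d) : 'cV[R]_d :=
  map_mx (Num.max 0) x.

(* [relu_net R n m] is the type of representations of maps R^m -> R^n: a list
   of weights and biases, of which the last layer [OutputLayer] has no
   activation.  Hidden widths are successors because they must be positive. *)
Inductive relu_net (R : realType) (n : nat) : nat -> Type :=
| OutputLayer m of 'M[R]_(n, m) & 'cV[R]_n : relu_net R n m
| HiddenLayer m k of 'M[R]_(k.+1, m) & 'cV[R]_k.+1 & relu_net R n k.+1 :
    relu_net R n m.

Fixpoint relu_net_eval (R : realType) (n m : nat) (N : relu_net R n m) :
    'cV[R]_m -> 'cV[R]_n :=
  match N in relu_net _ _ m return 'cV[R]_m -> 'cV[R]_n with
  | OutputLayer _ W b => fun x => W *m x + b
  | HiddenLayer _ _ W b N' => fun x => relu_net_eval N' (relu (W *m x + b))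
  end.

Definition is_relu_mlp (R : realType) (m n : nat)
    (Phi : 'cV[R]_m -> 'cV[R]_n) : Prop :=
  exists N : relu_net R n m, Phi =1 relu_net_eval N.

(* Main.v *)
(** The McShane extension [x |-> min_a (f a + w |x - a|)] is [w]-uniformly
    continuous but not piecewise linear.  Only the finitely many distances
    between points of [A] matter, so [w] may be replaced by its piecewise linear
    interpolation [v] at these distances, which is constant beyond the last one.
    By concavity [v <= w], so the McShane extension with [v] in place of [w] is
    still [w]-uniformly continuous; and [v] is a minimum of finitely many
    nondecreasing affine functions, so this extension is a finite minimum of
    functions [f a + s |x - a| + c], which a ReLU network computes. *)
Require Import Defs.
From mathcomp Require Import interval_inference.
From mathcomp Require Import ring lra.
Set Implicit Arguments.
Unset Strict Implicit.
Unset Printing Implicit Defensive.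

Import Order.TTheory GRing.Theory Num.Theory.
Import numFieldNormedType.Exports.
Local Open Scope classical_set_scope.
Local Open Scope ring_scope.

(** * Replacing a concave modulus by finitely many lines *)

(** Concavity with weight [(r - q) / (r - p)] on [p]; denominators are cleared so that the three
    points may coincide. *)
Lemma concave_modulus_chord (R : realType) (w : R -> R) (p q r : R) :
  concave_modulus w -> 0 <= p -> p <= q -> q <= r ->
  (r - q) * w p + (q - p) * w r <= (r - p) * w q.
Proof.
move=> [_ w_conv] p0 pq qr.
have [pr|pr] := eqVneq p r.
  have -> : q = p by apply/le_anti; rewrite pq pr qr.
  by rewrite -pr; lra.
have pr0 : 0 < r - p by rewrite subr_gt0 lt_def eq_sym pr (le_trans pq qr).
have t01 : 0 <= (r - q) / (r - p) <= 1.
  by rewrite ler_pdivlMr// ler_pdivrMr//; lra.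
have inD (u : R) : 0 <= u -> u \in [set` `[0, +oo[].
  by move=> u0; rewrite inE /= in_itv/= u0.
set t := (r - q) / (r - p) in t01 *.
have h : - w (t * p + (1 - t) * r) <= t * - w p + (1 - t) * - w r.
  exact: w_conv (Itv01 (andP t01).1 (andP t01).2) p r (inD _ p0)
           (inD _ (le_trans p0 (le_trans pq qr))).
have tE : t * p + (1 - t) * r = q by rewrite /t; field; rewrite gt_eqF.
have {h tE} h : t * w p + (1 - t) * w r <= w q by rewrite tE in h; lra.
rewrite -(ler_pM2l pr0) in h; apply: le_trans h.
by rewrite le_eqVlt; apply/orP; left; apply/eqP; rewrite /t; field; rewrite gt_eqF.
Qed.

(* The pair [(s, c)] in [L] stands for the line [t |-> s * t + c]. *)
Lemma concave_modulus_path_lines (R : realType) (w : R -> R) (x : R)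
    (D : seq R) :
  concave_modulus w -> 0 <= x -> path <=%R x D ->
  exists L : seq (R * R),
    [/\ forall l, l \in L -> 0 <= l.1,
        forall l u, l \in L -> 0 <= u -> u <= x \/ u \in D ->
          w u <= l.1 * u + l.2
      & forall t, x <= t -> exists2 l, l \in L & l.1 * t + l.2 <= w t].
Proof.
move=> cw; have [[w0 w_mono _ _] _] := cw.
elim: D x => [|y D IH] x x0 /=.
  (* Beyond the last point a horizontal line suffices, since [w] is nondecreasing. *)
  move=> _; exists [:: (0, w x)]; split.
  - by move=> l; rewrite inE => /eqP ->.
  - move=> l u; rewrite inE => /eqP -> /= u0 [ux|//].
    by rewrite mul0r add0r w_mono.
  - by move=> t xt; exists (0, w x); rewrite ?inE//= mul0r add0r w_mono.
move=> /andP[xy yD]; have [L [L1 L2 L3]] := IH y (le_trans x0 xy) yD.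
have Ly l u : l \in L -> 0 <= u -> u <= x \/ u \in y :: D ->
    w u <= l.1 * u + l.2.
  move=> lL u0 hu; apply: L2 => //; case: hu => [ux|].
    by left; exact: le_trans ux xy.
  by rewrite inE => /orP[/eqP ->|]; [left|right].
have [xey|xny] := eqVneq x y.
  by exists L; split=> // t; rewrite xey; exact: L3.
have xy0 : 0 < y - x by rewrite subr_gt0 lt_def eq_sym xny xy.
(* Slope of the chord of [w] over [[x, y]]. By concavity [w] is at most the chord's line outside the
   open interval, where all prescribed points lie, and at least the chord inside. *)
pose s := (w y - w x) / (y - x).
have lineE u : (y - x) * (s * u + (w x - s * x)) =
    (y - u) * w x + (u - x) * w y.
  by rewrite /s; field; rewrite gt_eqF.
exists ((s, w x - s * x) :: L); split.
- move=> l; rewrite inE => /orP[/eqP ->/=|]; last exact: L1.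
  by rewrite divr_ge0 ?subr_ge0 ?w_mono.
- move=> l u; rewrite inE => /orP[/eqP ->/= u0 hu|]; last exact: Ly.
  rewrite -(ler_pM2l xy0) lineE.
  case: hu => [ux|uD].
    by have := concave_modulus_chord cw u0 ux xy; lra.
  have yu : y <= u.
    move: uD; rewrite inE => /orP[/eqP ->//|].
    by move: yD => /(order_path_min le_trans)/allP; apply.
  by have := concave_modulus_chord cw x0 xy yu; lra.
- move=> t xt; have [ty|/ltW yt] := leP t y; last first.
    by have [l lL lt] := L3 t yt; exists l; rewrite // inE lL orbT.
  exists (s, w x - s * x); rewrite ?inE ?eqxx//= -(ler_pM2l xy0) lineE.
  exact: concave_modulus_chord.
Qed.

(** The path starts at [0], where [w] vanishes, so a line above [w] there has a nonnegative
    intercept. This is what later makes the minimum of the lines subadditive. *)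
Lemma concave_modulus_lines (R : realType) (w : R -> R) (D : seq R) :
  concave_modulus w ->
  exists L : seq (R * R),
    [/\ forall l, l \in L -> 0 <= l.1 /\ 0 <= l.2,
        forall l u, l \in L -> 0 <= u -> u \in D -> w u <= l.1 * u + l.2
      & forall t, 0 <= t -> exists2 l, l \in L & l.1 * t + l.2 <= w t].
Proof.
move=> cw; have [[_ _ w00 _] _] := cw.
pose E := sort <=%R [seq u <- D | 0 <= u].
have pE : path <=%R 0 E.
  rewrite (path_sortedE le_trans) (sort_sorted le_total) andbT.
  by apply/allP => u; rewrite mem_sort mem_filter => /andP[].
have [L [L1 L2 L3]] := concave_modulus_path_lines cw (lexx 0) pE.
exists L; split=> //.
- move=> l lL; split; first exact: L1.
  by have := L2 l 0 lL (lexx 0) (or_introl (lexx 0)); rewrite w00 mulr0 add0r.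
- move=> l u lL u0 uD; apply: L2 => //; right.
  by rewrite mem_sort mem_filter u0.
Qed.

(** * Closure properties of ReLU networks *)

Section Networks.
Context {R : realType}.

Lemma is_relu_mlp_affine (m n : nat) (W : 'M[R]_(n, m)) (b : 'cV[R]_n) :
  is_relu_mlp (fun x => W *m x + b).
Proof. by exists (OutputLayer W b). Qed.

(** The output layer of [h] has no activation, so it merges with the first affine map of [g]. *)
Lemma is_relu_mlp_comp (m n p : nat) (g : 'cV[R]_n -> 'cV[R]_p)
    (h : 'cV[R]_m -> 'cV[R]_n) :
  is_relu_mlp g -> is_relu_mlp h -> is_relu_mlp (g \o h).
Proof.
move=> [Ng gE] [Nh hE].
suff [N NE] : exists N : relu_net R p m,
    relu_net_eval N =1 relu_net_eval Ng \o relu_net_eval Nh.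
  by exists N => x; rewrite NE /= gE hE.
elim: Nh {h hE} => [k W b|k l W b Nh [N NE]]; last first.
  by exists (HiddenLayer W b N) => x; rewrite /= NE.
case: Ng {g gE} W b => [k' W' b'|k' l W' b' N] W b.
- exists (OutputLayer (W' *m W) (W' *m b + b')) => x /=.
  by rewrite mulmxDr mulmxA addrA.
- exists (HiddenLayer (W' *m W) (W' *m b + b') N) => x /=.
  by rewrite mulmxDr mulmxA addrA.
Qed.

(* Identity is passed through the hidden layer as [relu x - relu (- x)]; the
   zero row keeps the hidden width positive. *)
Lemma is_relu_mlp_residual (m n q : nat) (U : 'M[R]_(n, m)) (V : 'M[R]_(q, m))
    (W : 'M[R]_(n, q)) :
  is_relu_mlp (fun x => U *m x + W *m relu (V *m x)).
Proof.
pose H : 'M[R]_(1 + (m + (m + q)), m) :=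
  col_mx 0 (col_mx 1%:M (col_mx (- 1%:M) V)).
pose O : 'M[R]_(n, 1 + (m + (m + q))) := row_mx 0 (row_mx U (row_mx (- U) W)).
suff OHE x : U *m x + W *m relu (V *m x) = O *m relu (H *m x).
  exists (@HiddenLayer R n m (m + (m + q)) H 0 (OutputLayer O 0)) => x /=.
  by rewrite !addr0; exact: OHE.
rewrite !mul_col_mx /relu !map_col_mx !mul_row_col mul0mx add0r addrA.
congr (_ + _); rewrite mul1mx !mulNmx mul1mx -mulmxBr; congr (_ *m _).
apply/matrixP => i j; rewrite !mxE.
by rewrite /Num.max; do 2 case: ifPn => ?; lra.
Qed.

(* Appending the value of [g] to a register [x] of which [g] reads a linear image
   makes sums of networks of different depths a matter of composition. *)
Definition relu_appendable (m : nat) (g : 'cV[R]_m -> R) : Prop :=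
  forall k (P : 'M[R]_(m, k)),
    is_relu_mlp (fun x : 'cV[R]_k => col_mx x ((g (P *m x))%:M : 'cV[R]_1)).

Lemma is_relu_mlp_appendable (m : nat) (g : 'cV[R]_m -> R) :
  relu_appendable g -> is_relu_mlp (fun x => (g x)%:M : 'cV[R]_1).
Proof.
move=> /(_ m 1%:M) hg.
have [N NE] := is_relu_mlp_comp (is_relu_mlp_affine (row_mx 0 1%:M) 0) hg.
by exists N => x; rewrite -NE /= addr0 mul_row_col mul0mx add0r !mul1mx.
Qed.

Lemma relu_appendable_affine (m : nat) (a : 'rV[R]_m) (b : R) :
  relu_appendable (fun x => (a *m x) 0 0 + b).
Proof.
move=> k P.
have [N NE] := is_relu_mlp_affine (col_mx 1%:M (a *m P)) (col_mx 0 b%:M).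
exists N => x; rewrite -NE mul_col_mx add_col_mx mul1mx addr0 -mulmxA.
by rewrite raddfD /= -mx11_scalar.
Qed.

Lemma relu_appendable_lincomb (m : nat) (a b : R) (g h : 'cV[R]_m -> R) :
  relu_appendable g -> relu_appendable h ->
  relu_appendable (fun x => a * g x + b * h x).
Proof.
move=> hg hh k P.
(* The zero block makes [h] ignore the value of [g] appended just before; [C] then combines both
   values into one. *)
have mg := hg k P; have mh := hh (k + 1)%N (row_mx P 0).
pose C : 'M[R]_(k + 1, k + 1 + 1) :=
  col_mx (row_mx (row_mx 1%:M 0) 0) (row_mx (row_mx 0 a%:M) b%:M).
have [N NE] := is_relu_mlp_comp (is_relu_mlp_affine C 0)
                 (is_relu_mlp_comp mh mg).
exists N => x; rewrite -NE /= addr0 /C mul_col_mx !mul_row_col.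
rewrite !mul0mx !addr0 add0r mul1mx -!scalar_mxM.
by rewrite raddfD.
Qed.

Lemma relu_appendable_relu (m : nat) (g : 'cV[R]_m -> R) :
  relu_appendable g -> relu_appendable (fun x => Num.max 0 (g x)).
Proof.
move=> hg k P.
(* [U] keeps the register and erases the appended value, [V] reads that value, and [W] writes its
   positive part back. *)
pose U : 'M[R]_(k + 1, k + 1) := col_mx (row_mx 1%:M 0) 0.
pose V : 'M[R]_(1, k + 1) := row_mx 0 1%:M.
pose W : 'M[R]_(k + 1, 1) := col_mx 0 1%:M.
have [N NE] := is_relu_mlp_comp (is_relu_mlp_residual U V W) (hg k P).
exists N => x; rewrite -NE /= /U /V /W !mul_col_mx !mul_row_col.
rewrite !mul0mx !mul1mx addr0 add0r add_col_mx addr0 add0r; congr col_mx.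
by apply/matrixP => i j; rewrite !ord1 !mxE eqxx !mulr1n.
Qed.

Lemma eq_relu_appendable (m : nat) (g h : 'cV[R]_m -> R) :
  g =1 h -> relu_appendable g -> relu_appendable h.
Proof.
by move=> gh hg k P; have [N NE] := hg k P; exists N => x; rewrite -NE gh.
Qed.

Lemma relu_appendable_min (m : nat) (g h : 'cV[R]_m -> R) :
  relu_appendable g -> relu_appendable h ->
  relu_appendable (fun x => Num.min (g x) (h x)).
Proof.
move=> hg hh.
(* This is [min g h = g - max 0 (g - h)]. *)
have := relu_appendable_lincomb 1 (-1) hg
  (relu_appendable_relu (relu_appendable_lincomb 1 (-1) hg hh)).
apply: eq_relu_appendable => x.
by rewrite /Num.min /Num.max; do 2 case: ifPn => ?; lra.
Qed.

Lemma relu_appendable_norm (m : nat) (g : 'cV[R]_m -> R) :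
  relu_appendable g -> relu_appendable (fun x => `|g x|).
Proof.
move=> hg.
(* This is [|g| = 2 * max 0 g - g]. *)
have := relu_appendable_lincomb 2 (-1) (relu_appendable_relu hg) hg.
apply: eq_relu_appendable => x.
rewrite /Num.max; case: ifPn => gx; first by rewrite gtr0_norm//; lra.
by rewrite ler0_norm ?leNgt//; lra.
Qed.

Lemma relu_appendable_sum (m : nat) (I : Type) (r : seq I)
    (g : I -> 'cV[R]_m -> R) :
  (forall i, relu_appendable (g i)) ->
  relu_appendable (fun x => \sum_(i <- r) g i x).
Proof.
move=> hg; elim: r => [|i r IH].
  apply: eq_relu_appendable (relu_appendable_affine 0 0) => x.
  by rewrite big_nil mul0mx mxE addr0.
apply: eq_relu_appendable (relu_appendable_lincomb 1 1 (hg i) IH) => x.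
by rewrite big_cons !mul1r.
Qed.

Lemma relu_appendable_l1norm (d : nat) (a : 'cV[R]_d) (s b : R) :
  relu_appendable (fun x => s * l1norm (x - a) + b).
Proof.
have coord i : relu_appendable (fun x : 'cV[R]_d => `|(x - a) i 0|).
  apply: relu_appendable_norm.
  apply: eq_relu_appendable
    (relu_appendable_affine (delta_mx 0 i) (- a i 0)) => x.
  by rewrite -rowE !mxE.
have := relu_appendable_lincomb s b (relu_appendable_sum (index_enum 'I_d) coord)
  (relu_appendable_affine 0 1).
by apply: eq_relu_appendable => x; rewrite mul0mx mxE add0r mulr1.
Qed.

(** The minimum is described by its lower bound property and attainment; a real minimum has no
    neutral element, hence the nonempty list. *)
Lemma relu_appendable_bigmin (m : nat) (I : eqType) (r : seq I)
    (g : I -> 'cV[R]_m -> R) :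
  r != [::] -> (forall i, relu_appendable (g i)) ->
  exists G, [/\ relu_appendable G,
    forall x i, i \in r -> G x <= g i x
    & forall x, exists2 i, i \in r & G x = g i x].
Proof.
move=> + hg; elim: r => // i [_ _|j r /(_ isT) [G [G1 G2 G3]] _].
  exists (g i); split=> // [x k|x]; first by rewrite inE => /eqP ->.
  by exists i; rewrite ?inE.
exists (fun x => Num.min (g i x) (G x)); split.
- exact: relu_appendable_min.
- move=> x k; rewrite inE ge_min => /orP[/eqP ->|kr]; first by rewrite lexx.
  by rewrite G2 ?orbT.
- move=> x; case: (leP (g i x) (G x)) => _; first by exists i; rewrite ?mem_head.
  by have [k kr ->] := G3 x; exists k; rewrite // inE kr orbT.
Qed.

End Networks.

(** * Basic properties of the l1 norm *)

Section L1norm.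
Context {R : realType} {d : nat}.

Lemma l1norm_ge0 (x : 'cV[R]_d) : 0 <= l1norm x.
Proof. by apply: sumr_ge0. Qed.

Lemma l1norm0 : l1norm (0 : 'cV[R]_d) = 0.
Proof. by rewrite /l1norm big1// => i _; rewrite mxE normr0. Qed.

Lemma l1normD (x y : 'cV[R]_d) : l1norm (x + y) <= l1norm x + l1norm y.
Proof.
by rewrite /l1norm -big_split/=; apply: ler_sum => i _; rewrite mxE ler_normD.
Qed.

Lemma l1normN (x : 'cV[R]_d) : l1norm (- x) = l1norm x.
Proof. by apply: eq_bigr => i _; rewrite mxE normrN. Qed.

End L1norm.

(** * The piecewise linear McShane extension *)

Theorem corollary4p1 (R : realType) (d : nat) (d_gt0 : (0 < d)%N)
    (A : set 'cV[R]_d) (A_finite : finite_set A)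
    (A_dyadic : A `<=` @unit_cube R d `&`
      \bigcup_(n in [set n : nat | (0 < n)%N]) @dyadic_grid R d n)
    (w : R -> R) (w_modulus : concave_modulus w)
    (f : 'cV[R]_d -> R) (f_cont : uniformly_continuous_by w A f) :
  exists Phi : 'cV[R]_d -> 'cV[R]_1,
    [/\ is_relu_mlp Phi,
        uniformly_continuous_by w setT (fun x => Phi x 0 0)
      & forall x, A x -> f x = Phi x 0 0].
Proof.
have [[w_ge0 _ w00 _] _] := w_modulus.
have [S AE] := (finite_seqP A).1 A_finite.
have memS a : (a \in S) = true <-> A a by rewrite AE.
(* With no points there is nothing to minimize over; the zero network serves. *)
have [S0|S0] := eqVneq S [::].
  exists (fun x => 0 *m x + 0); split; first exact: is_relu_mlp_affine.
  - move=> x y _ _; rewrite !mul0mx subrr normr0.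
    exact/w_ge0/l1norm_ge0.
  - by move=> x /memS; rewrite S0.
pose D := [seq l1norm (x - a) | x <- S, a <- S].
have [L [L_ge0 L_ge L_le]] := concave_modulus_lines D w_modulus.
pose g (i : 'cV[R]_d * (R * R)) (x : 'cV[R]_d) :=
  i.2.1 * l1norm (x - i.1) + (i.2.2 + f i.1).
pose I := [seq (a, l) | a <- S, l <- L].
have memI a l : a \in S -> l \in L -> (a, l) \in I.
  by move=> aS lL; apply/allpairsP; exists (a, l).
have I0 : I != [::].
  have [l lL _] := L_le 0 (lexx 0).
  case: (S) S0 memI => // a S' _ /(_ a l (mem_head _ _) lL).
  by case: (I).
have [G [G_relu G_le G_eq]] :=
  relu_appendable_bigmin I0 (fun i => relu_appendable_l1norm i.1 i.2.1 (i.2.2 + f i.1)).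
have {}G_le x a l : a \in S -> l \in L ->
    G x <= l.1 * l1norm (x - a) + (l.2 + f a).
  by move=> aS lL; exact: (G_le x (a, l) (memI _ _ aS lL)).
have {}G_eq x : exists a l,
    [/\ a \in S, l \in L & G x = l.1 * l1norm (x - a) + (l.2 + f a)].
  have [_ /allpairsP[[a l] [aS lL ->]] Gx] := G_eq x.
  by exists a, l; split.
exists (fun x => (G x)%:M); split; first exact: is_relu_mlp_appendable.
(* A one-sided estimate suffices, as exchanging [x] and [y] bounds the absolute value. *)
- have G_incr x y : G x <= G y + w (l1norm (x - y)).
    have [a [l [aS lL ->]]] := G_eq y.
    have [l' l'L l'_le] := L_le _ (l1norm_ge0 (x - y)).
    have [l1 l2] := L_ge0 l lL; have [l1' l2'] := L_ge0 l' l'L.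
    have tri : l1norm (x - a) <= l1norm (x - y) + l1norm (y - a).
      by apply: le_trans (l1normD _ _); rewrite addrA subrK.
    have xy0 := l1norm_ge0 (x - y); have ya0 := l1norm_ge0 (y - a).
    (* Subadditivity of a minimum of lines: use the line of smaller slope. *)
    have [ll'|/ltW l'l] := leP l.1 l'.1.
      by apply: le_trans (G_le x a l aS lL) _; nra.
    by apply: le_trans (G_le x a l' aS l'L) _; nra.
  move=> x y _ _; rewrite !mxE eqxx !mulr1n ler_norml.
  have := G_incr x y; have := G_incr y x.
  by rewrite -(l1normN (y - x)) opprB; lra.
- move=> x /memS xS; rewrite mxE eqxx mulr1n; apply/le_anti/andP; split.
  (* The minimizing line dominates [w] at a distance in [D], so the continuity of [f] gives
     [f x <= G x]. *)
  + have [a [l [aS lL ->]]] := G_eq x.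
    have wD : w (l1norm (x - a)) <= l.1 * l1norm (x - a) + l.2.
      apply: L_ge => //; first exact: l1norm_ge0.
      by apply/allpairsP; exists (x, a).
    have := f_cont x a ((memS x).1 xS) ((memS a).1 aS).
    by move=> /(le_trans (ler_norm _)); lra.
  (* For the converse, take the centre [x] itself and a line with intercept at most [w 0 = 0]. *)
  + have [l lL] := L_le 0 (lexx 0).
    rewrite w00 => l0; apply: le_trans (G_le x x l xS lL) _.
    by rewrite subrr l1norm0; lra.
Qed.
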